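(* Let $(Q,L_d,D_K,D_V)$ be a discrete second order constrained Lagrangian system (DSOCS) with discrete flow $F_{L_d}:C_d\to F_{L_d}(C_d)$. Let $\Omega_{L_d}^{C_d}\in\Omega^2(C_d)$ and $\Omega_{L_d}^{F_{L_d}(C_d)}\in\Omega^2(F_{L_d}(C_d))$ be the restrictions (pullbacks by inclusion) of the discrete Lagrangian $2$-form $\Omega_{L_d}$ to the corresponding submanifolds of $Q\times Q$. Then $$(F_{L_d})^*\left(\Omega_{L_d}^{F_{L_d}(C_d)}\right)=\Omega_{L_d}^{C_d}+d\xi,$$ where $\xi\in\Omega^1(C_d)$ is defined by $$\xi(q_0,q_1)(\delta q_0,\delta q_1):=\big(\mathcal{F}^+L_d(q_0,q_1)-\mathcal{F}^-L_d(F_{L_d}(q_0,q_1))\big)(\delta q_1)$$ for all $(q_0,q_1)\in C_d$ and all $(\delta q_0,\delta q_1)\in T_{(q_0,q_1)}C_d$.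
   Context: Notation: $p_j^m:Q^m\to Q$ is the projection onto the $j$-th factor. A discrete second order constrained Lagrangian system (DSOCS) is a quadruple $(Q,L_d,D_K,D_V)$ where: $Q$ is a finite dimensional differentiable manifold; $L_d:Q\times Q\to\mathbb{R}$ is a smooth function; $D_K\subset Q\times Q\times Q$ is a submanifold; and $D_V\subset (p_2^3)^*(TQ)$ (pullback bundle over $Q^3$) is such that for every $(q,q',q'')\in Q^3$ the subset $D_V|_{(q,q',q'')}:=D_V\cap(\{(q,q',q'')\}\times T_{q'}Q)$, identified with a subset of $T_{q'}Q$, is a vector subspace. The discrete action of a discrete path $q_\cdot:\{0,\ldots,N\}\to Q$ is $S_d(q_\cdot):=\sum_{k=0}^{N-1}L_d(q_k,q_{k+1})$. An infinitesimal variation of $q_\cdot$ is a map $\delta q_\cdot:\{0,\ldots,N\}\to TQ$ with $\delta q_k\in T_{q_k}Q$ for all $k$; it has vanishing end points if $\delta q_0=0$ and $\delta q_N=0$. A discrete path $q_\cdot:\{0,\ldots,N\}\to Q$, $N\ge2$, is a trajectory of the DSOCS if (1) $(q_{k-1},q_k,q_{k+1})\in D_K$ for all $k\in\{1,\ldots,N-1\}$, and (2) $dS_d(q_\cdot)(\delta q_\cdot)=0$ for all infinitesimal variations $\delta q_\cdot$ with vanishing end points such that $\delta q_k\in D_V|_{(q_{k-1},q_k,q_{k+1})}$ for all $k\in\{1,\ldots,N-1\}$. A discrete flow of the DSOCS is a diffeomorphism $F_{L_d}:C_d\to F_{L_d}(C_d)$ between submanifolds of $Q\times Q$, such that $F_{L_d}(q_0,q_1)=(q_1,q_2)$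 for some trajectory $(q_0,q_1,q_2)$ with $(q_0,q_1)\in C_d$, and such that for all $(\hat q_0,\hat q_1)\in C_d$ one has $p_1^2(F_{L_d}(\hat q_0,\hat q_1))=\hat q_1$ and $(\hat q_0,\hat q_1,(p_2^2\circ F_{L_d})(\hat q_0,\hat q_1))$ is a trajectory of the system. $D_jL_d(q,q')$ denotes the partial derivative of $L_d$ with respect to its $j$-th argument. The discrete Legendre transforms $\mathcal{F}^\pm L_d:Q\times Q\to T^*Q$ are $\mathcal{F}^-L_d(q,q'):=(q,-D_1L_d(q,q'))\in T_q^*Q$ and $\mathcal{F}^+L_d(q,q'):=(q',D_2L_d(q,q'))\in T_{q'}^*Q$. The discrete Lagrangian $1$-forms $\theta_{L_d}^\pm\in\Omega^1(Q\times Q)$ are $\theta_{L_d}^-(q,q')(v_q,v_{q'}):=\mathcal{F}^-L_d(q,q')(v_q)$ and $\theta_{L_d}^+(q,q')(v_q,v_{q'}):=\mathcal{F}^+L_d(q,q')(v_{q'})$ for $(v_q,v_{q'})\in T_{(q,q')}(Q\times Q)$. The discrete Lagrangian $2$-form is $\Omega_{L_d}:=-d\theta_{L_d}^+=-d\theta_{L_d}^-\in\Omega^2(Q\times Q)$ (the two agree because $dL_d=\theta_{L_d}^+-\theta_{L_d}^-$). No regularity of $L_d$ is assumed. *)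

(* Defs.v *)
From HB Require Import structures.
From mathcomp Require Import all_boot all_order all_algebra.
From mathcomp Require Import all_classical all_reals all_analysis.
Set Implicit Arguments.
Unset Strict Implicit.
Unset Printing Implicit Defensive.
Import Order.TTheory GRing.Theory Num.Theory.
Import numFieldNormedType.Exports.
Local Open Scope classical_set_scope.
Local Open Scope ring_scope.

(* [iter_derive [:: v1; ...; vk] f] is D_v1 (... (D_vk f)). *)
Fixpoint iter_derive {R : realType} {E F : normedModType R} (vs : seq E)
    (f : E -> F) : E -> F :=
  if vs is v :: vs' then 'D_v (iter_derive vs' f) else f.

(* C^oo on U: all iterated directional derivatives, of all orders, exist and
   are differentiable at every point of U.  Only used for U open. *)
Definition smooth_on {R : realType} {E F : normedModType R} (U : set E)
    (f : E -> F) : Prop :=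
  forall (vs : seq E) (x : E), U x -> differentiable (iter_derive vs f) x.

(* A homeomorphism from the open set [dom] onto an open subset of E; the values
   of [fwd] outside [dom] and of [bwd] outside the image are irrelevant. *)
Record chart {R : realType} (X : topologicalType) (E : normedModType R) :=
  Chart {
    dom : set X;
    fwd : X -> E;
    bwd : E -> X;
    dom_open : open dom;
    cod_open : open (fwd @` dom);
    fwdK : forall x, dom x -> bwd (fwd x) = x;
    fwd_cont : forall x, dom x -> {for x, continuous fwd};
    bwd_cont : forall y, (fwd @` dom) y -> {for y, continuous bwd} }.

(* The smooth structure is the one of the atlas {chart_at x | x in X}: every
   point comes with a preferred chart around it. *)
Record smooth_structure {R : realType} (X : topologicalType)
    (E : normedModType R) := SmoothStructure {
  chart_at : X -> chart X E;
  chart_at_dom : forall x, dom (chart_at x) x;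
  chart_compat : forall x y,
    smooth_on (fwd (chart_at x) @` (dom (chart_at x) `&` dom (chart_at y)))
              (fwd (chart_at y) \o bwd (chart_at x));
  smooth_hausdorff : hausdorff_space X;
  smooth_second_countable : @second_countable X }.

Record manifold {R : realType} (E : normedModType R) := Manifold {
  carrier :> topologicalType;
  structure_of : smooth_structure carrier E }.

Notation chart_around x := (chart_at (structure_of _) x).

(* A tangent vector at x is given by its coordinates in the preferred chart
   around x. *)
Definition tangent {R : realType} {E : normedModType R} (M : manifold E)
  (x : M) : normedModType R := E.

Definition cotangent {R : realType} {E : normedModType R} (M : manifold E)
  (x : M) := {linear tangent x -> R^o}.

Definition cotangent_bundle {R : realType} {E : normedModType R}
  (M : manifold E) := {x : M & cotangent x}.

Definition smooth_map {R : realType} {E F : normedModType R}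
    (M : manifold E) (N : manifold F) (f : M -> N) : Prop :=
  continuous f /\
  forall (x : M) (y : N),
    smooth_on
      (fwd (chart_around x) @`
        (dom (chart_around x) `&` f @^-1` dom (chart_around y)))
      (fwd (chart_around y) \o f \o bwd (chart_around x)).

Definition tangent_map {R : realType} {E F : normedModType R}
    (M : manifold E) (N : manifold F) (f : M -> N) (x : M) :
    {linear tangent x -> tangent (f x)} :=
  'd (fwd (chart_around (f x)) \o f \o bwd (chart_around x))
     (fwd (chart_around x) x).

Definition smooth_function {R : realType} {E : normedModType R}
    (M : manifold E) (f : M -> R) : Prop :=
  forall x : M, smooth_on (fwd (chart_around x) @` dom (chart_around x))
                          (f \o bwd (chart_around x) : E -> R^o).

Definition differential {R : realType} {E : normedModType R}
    (M : manifold E) (f : M -> R) (x : M) : cotangent x :=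
  'd (f \o bwd (chart_around x) : E -> R^o) (fwd (chart_around x) x).

Definition diffeomorphism {R : realType} {E F : normedModType R}
    (M : manifold E) (N : manifold F) (f : M -> N) : Prop :=
  smooth_map f /\
  exists g : N -> M, [/\ cancel f g, cancel g f & smooth_map g].

Lemma image_setX {T1 T2 U1 U2 : Type} (A : set T1) (B : set T2) (f : T1 -> U1)
    (g : T2 -> U2) :
  (fun p : T1 * T2 => (f p.1, g p.2)) @` (A `*` B) = (f @` A) `*` (g @` B).
Proof.
apply/seteqP; split=> [_ [[x y] [/= Ax By] <-]|[u v] /= [[x Ax <-] [y By <-]]].
  by split; [exists x|exists y].
by exists (x, y).
Qed.

Lemma open_setX {X Y : topologicalType} (A : set X) (B : set Y) :
  open A -> open B -> open (A `*` B).
Proof.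
move=> oA oB; rewrite openE => -[x y] [/= Ax By].
by exists (A, B) => //=; split; apply: open_nbhs_nbhs.
Qed.

Lemma hausdorff_prod (X Y : topologicalType) :
  hausdorff_space X -> hausdorff_space Y -> hausdorff_space (X * Y)%type.
Proof.
move=> hX hY [x y] [x' y'] xy; congr pair.
- apply: hX => A B nA nB; case: (xy (A `*` setT) (B `*` setT)).
  + by exists (A, setT) => //; split => //=; exact: filterT.
  + by exists (B, setT) => //; split => //=; exact: filterT.
  + by move=> [a b] [[/= ? _] [/= ? _]]; exists a.
- apply: hY => A B nA nB; case: (xy (setT `*` A) (setT `*` B)).
  + by exists (setT, A) => //; split => //=; exact: filterT.
  + by exists (setT, B) => //; split => //=; exact: filterT.
  + by move=> [a b] [[/= _ ?] [/= _ ?]]; exists b.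
Qed.

Lemma second_countable_prod (X Y : topologicalType) :
  @second_countable X -> @second_countable Y -> @second_countable (X * Y)%type.
Proof.
move=> [B cB [oB bB]] [C cC [oC bC]].
exists ((fun p => p.1 `*` p.2) @` (B `*` C)).
  by apply: sub_countable (card_image_le _ _) _; exact: countableX.
split=> [_ [[U V] [/= BU CV] <-]|[x y] W [[S T] /= [nS nT] STW]].
  by apply: open_setX; [exact: oB|exact: oC].
have [U [BU Ux] US] := bB x S nS.
have [V [CV Vy] VT] := bC y T nT.
exists (U `*` V); first by split=> //; exists (U, V).
by move=> [a b] [/= Ua Vb]; apply: STW; split; [exact: US|exact: VT].
Qed.

Lemma is_diff_fst {R : realType} {E F : normedModType R} (p : E * F) :
  is_diff p (fst : E * F -> E) fst.
Proof.
have lin : linear (fst : E * F -> E) by [].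
pose L : {linear (E * F)%type -> E} := HB.pack (fst : E * F -> E)
  (GRing.isLinear.Build _ _ _ _ _ lin).
have cL : continuous L by move=> q; exact: cvg_fst.
by apply: DiffDef; [exact: (linear_differentiable p cL)|exact: (diff_lin p cL)].
Qed.

Lemma is_diff_snd {R : realType} {E F : normedModType R} (p : E * F) :
  is_diff p (snd : E * F -> F) snd.
Proof.
have lin : linear (snd : E * F -> F) by [].
pose L : {linear (E * F)%type -> F} := HB.pack (snd : E * F -> F)
  (GRing.isLinear.Build _ _ _ _ _ lin).
have cL : continuous L by move=> q; exact: cvg_snd.
by apply: DiffDef; [exact: (linear_differentiable p cL)|exact: (diff_lin p cL)].
Qed.

Lemma near_eq_differentiable {R : realType} {E F : normedModType R}
    (f g : E -> F) (x : E) :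
  {near x, f =1 g} -> differentiable f x -> differentiable g x.
Proof.
move=> fg df; have [dc fE] := (diff_locallyP _ _).1 df.
have gE : g \o shift x = cst (g x) + 'd f x +o_ 0 id.
  have fgx : f x = g x by exact: nbhs_singleton fg.
  apply/eqaddoP => e e0; have := (eqaddoP _ _ _ _).1 fE e e0.
  have fg0 : \forall y \near (0 : E), f (y + x) = g (y + x).
    move: fg; rewrite (near_shift 0 x) subr0 => fg.
    by apply: filterS fg => y.
  apply: filterS2 fg0 => y /= fgy.
  by rewrite !fctE /= fgx fgy.
apply/diff_locallyP; rewrite (diff_unique dc gE) //.
Qed.

Lemma smooth_on_prod {R : realType} {E E' F F' : normedModType R} (U : set E)
    (V : set F) (f : E -> E') (g : F -> F') :
  open U -> open V -> smooth_on U f -> smooth_on V g ->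
  smooth_on (U `*` V) (fun p : E * F => (f p.1, g p.2)).
Proof.
move=> oU oV sf sg.
pose h (p : E * F) := (f p.1, g p.2).
pose k ws (p : E * F) :=
  (iter_derive (map fst ws) f p.1, iter_derive (map snd ws) g p.2).
have dk ws p : (U `*` V) p ->
    is_diff p (k ws) (fun w => ('d (iter_derive (map fst ws) f) (p.1) w.1,
                                'd (iter_derive (map snd ws) g) (p.2) w.2)).
  move=> [Up Vp]; apply: is_diff_pair.
    apply: is_diff_comp (is_diff_fst p) _.
    by apply: DiffDef => //; exact: sf.
  apply: is_diff_comp (is_diff_snd p) _.
  by apply: DiffDef => //; exact: sg.
have hk ws p : (U `*` V) p -> iter_derive ws h p = k ws p.
  elim: ws p => [//|w ws IH] p UVp /=.
  have /near_eq_derive -> : {near p, iter_derive ws h =1 k ws}.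
    by near=> q; apply: IH; near: q; apply: open_nbhs_nbhs; split=> //;
       exact: open_setX.
  have [? dE] := dk ws p UVp.
  rewrite deriveE// dE /k /= !deriveE//; first by apply: sg; case: UVp.
  by apply: sf; case: UVp.
move=> ws p UVp; apply: (@near_eq_differentiable _ _ _ (k ws)).
  near=> q; apply/esym/hk; near: q; apply: open_nbhs_nbhs; split=> //.
  exact: open_setX.
by have [] := dk ws p UVp.
Unshelve. all: by end_near.
Qed.

Section Product.
Context {R : realType} {E F : normedModType R}.

Section Charts.
Context {X Y : topologicalType}.
Variables (c : chart X E) (d : chart Y F).

Let pdom : set (X * Y) := dom c `*` dom d.
Let pfwd (p : X * Y) : E * F := (fwd c p.1, fwd d p.2).
Let pbwd (p : E * F) : X * Y := (bwd c p.1, bwd d p.2).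

Let pdom_open : open pdom.
Proof. exact: open_setX (dom_open c) (dom_open d). Qed.

Let pcod_open : open (pfwd @` pdom).
Proof. by rewrite image_setX; exact: open_setX (cod_open c) (cod_open d). Qed.

Let pfwdK p : pdom p -> pbwd (pfwd p) = p.
Proof. by case: p => x y [/= cx dy]; rewrite /pbwd /= !fwdK. Qed.

Let pfwd_cont p : pdom p -> {for p, continuous pfwd}.
Proof.
case: p => x y [/= cx dy]; apply: cvg_pair => /=.
  by apply: (@cvg_comp _ _ _ fst (fwd c) _ (nbhs x)); [exact: cvg_fst|exact: fwd_cont].
by apply: (@cvg_comp _ _ _ snd (fwd d) _ (nbhs y)); [exact: cvg_snd|exact: fwd_cont].
Qed.

Let pbwd_cont q : (pfwd @` pdom) q -> {for q, continuous pbwd}.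
Proof.
rewrite image_setX; case: q => u v [/= cu dv]; apply: cvg_pair => /=.
  by apply: (@cvg_comp _ _ _ fst (bwd c) _ (nbhs u)); [exact: cvg_fst|exact: bwd_cont].
by apply: (@cvg_comp _ _ _ snd (bwd d) _ (nbhs v)); [exact: cvg_snd|exact: bwd_cont].
Qed.

Definition prod_chart : chart (X * Y)%type (E * F)%type :=
  Chart pdom_open pcod_open pfwdK pfwd_cont pbwd_cont.

End Charts.

Lemma overlap_open {X : topologicalType} {G : normedModType R}
  (c : chart X G) (A : set X) : open A -> open (fwd c @` (dom c `&` A)).
Proof.
move=> oA; rewrite openE => _ [x [cx Ax] <-]; rewrite /interior.
have cxI : (fwd c @` dom c) (fwd c x) by exists x.
have n1 : nbhs (fwd c x) (fwd c @` dom c).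
  by apply: open_nbhs_nbhs; split=> //; exact: cod_open.
have n2 : nbhs (fwd c x) (bwd c @^-1` A).
  by apply: (bwd_cont cxI); rewrite fwdK//; exact: open_nbhs_nbhs.
apply: filterS (filterI n1 n2) => _ [[z cz <-]] /=; rewrite fwdK// => Az.
by exists z.
Qed.

Variables (M : manifold E) (N : manifold F).

Let pchart (p : M * N) := prod_chart (chart_around p.1) (chart_around p.2).

Let pchart_dom p : dom (pchart p) p.
Proof. by split; exact: chart_at_dom. Qed.

Let pchart_compat p q :
  smooth_on (fwd (pchart p) @` (dom (pchart p) `&` dom (pchart q)))
            (fwd (pchart q) \o bwd (pchart p)).
Proof.
have -> : dom (pchart p) `&` dom (pchart q) =
  (dom (chart_around p.1) `&` dom (chart_around q.1)) `*`
  (dom (chart_around p.2) `&` dom (chart_around q.2)).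
  by apply/seteqP; split=> [[a b] [[? ?] [? ?]]|[a b] [[? ?] [? ?]]].
rewrite image_setX.
have oM := overlap_open (chart_around p.1) (dom_open (chart_around q.1)).
have oN := overlap_open (chart_around p.2) (dom_open (chart_around q.2)).
have := @smooth_on_prod _ _ _ _ _ _ _ _ _ oM oN
  (@chart_compat _ _ _ (structure_of M) p.1 q.1)
  (@chart_compat _ _ _ (structure_of N) p.2 q.2).
exact.
Qed.

(* The preferred chart around (x, y) is the product of the preferred charts, so
   that a tangent vector at (x, y) is a pair of tangent vectors at x and y. *)
Definition prod_structure : smooth_structure (M * N)%type (E * F)%type :=
  SmoothStructure pchart_dom pchart_compat
    (hausdorff_prod (smooth_hausdorff (structure_of M))
                    (smooth_hausdorff (structure_of N)))
    (second_countable_prod (smooth_second_countable (structure_of M))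
                           (smooth_second_countable (structure_of N))).

Definition prod_manifold : manifold (E * F)%type := Manifold prod_structure.

End Product.

(* An embedded submanifold: a subset with the subspace topology and a smooth
   structure for which the inclusion is an immersion. *)
Record submanifold {R : realType} {E : normedModType R} (M : manifold E) :=
  Submanifold {
    subset_of : set M;
    sub_dim : nat;
    sub_structure : smooth_structure (set_type subset_of) 'rV[R]_sub_dim;
    sub_manifold := Manifold sub_structure;
    inclusion : sub_manifold -> M := set_val;
    inclusion_smooth : smooth_map inclusion;
    inclusion_immersion : forall x, injective (tangent_map inclusion x) }.

Coercion sub_manifold : submanifold >-> manifold.
Arguments inclusion {R E M} s _.

(* Not assumed smooth, nor (multi)linear in the tangent vectors: the elements of
   Omega^1(M) are the [field1 M] satisfying [is_form1] below. *)
Definition field1 {R : realType} {E : normedModType R} (M : manifold E) :=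
  forall x : M, tangent x -> R.

Definition field2 {R : realType} {E : normedModType R} (M : manifold E) :=
  forall x : M, tangent x -> tangent x -> R.

Definition pullback1 {R : realType} {E F : normedModType R}
    (M : manifold E) (N : manifold F) (f : M -> N) (a : field1 N) : field1 M :=
  fun x v => a (f x) (tangent_map f x v).

Definition pullback2 {R : realType} {E F : normedModType R}
    (M : manifold E) (N : manifold F) (f : M -> N) (w : field2 N) : field2 M :=
  fun x u v => w (f x) (tangent_map f x u) (tangent_map f x v).

(* The expression of [a] in the coordinates of the chart [c], i.e., the pullback
   of [a] by [bwd c] evaluated at the point y on the vector v. *)
Definition in_chart {R : realType} {E : normedModType R} (M : manifold E)
    (c : chart M E) (a : field1 M) (y v : E) : R^o :=
  a (bwd c y) ('d (fwd (chart_around (bwd c y)) \o bwd c) y v).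

Definition is_form1 {R : realType} {E : normedModType R} (M : manifold E)
    (a : field1 M) : Prop :=
  (forall x : M, linear (a x : tangent x -> R^o)) /\
  (forall (x : M) (v : E),
     smooth_on (fwd (chart_around x) @` dom (chart_around x))
               (fun y => in_chart (chart_around x) a y v)).

(* In coordinates, (da)(u, v) = D_u (a(v)) - D_v (a(u)) for constant u and v. *)
Definition ext_d {R : realType} {E : normedModType R} (M : manifold E)
    (a : field1 M) : field2 M :=
  fun x u v =>
    let c := chart_around x in
    'D_u (fun y => in_chart c a y v) (fwd c x)
    - 'D_v (fun y => in_chart c a y u) (fwd c x).

Arguments pullback1 {R E F M N} f a x v.
Arguments pullback2 {R E F M N} f w x u v.
Arguments in_chart {R E M} c a y v.
Arguments ext_d {R E M} a x u v.

Section Discrete.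
Context {R : realType} {n : nat} (Q : manifold 'rV[R]_n).

Local Notation QQ := (prod_manifold Q Q).
Local Notation QQQ := (prod_manifold QQ Q).

(* The total space of the pullback of TQ by the second projection Q^3 -> Q. *)
Definition pullback_tangent_bundle := {p : QQQ & tangent p.1.2}.

Definition fiber (D : set pullback_tangent_bundle) (q q' q'' : Q) :
    set (tangent q') :=
  [set v | D (existT (fun p : QQQ => tangent p.1.2) (q, q', q'') v)].

Arguments fiber : clear implicits.

Definition is_subspace (V : lmodType R) (A : set V) : Prop :=
  A 0 /\ forall (a : R) (u v : V), A u -> A v -> A (a *: u + v).

Record dsocs := Dsocs {
  Ld : QQ -> R;
  DK : submanifold QQQ;
  DV : set pullback_tangent_bundle;
  Ld_smooth : smooth_function Ld;
  DV_subspace : forall q q' q'' : Q, is_subspace (fiber DV q q' q'') }.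

Section Trajectory.
Variables (N : nat).

Definition discrete_path := 'I_N.+1 -> Q.

Definition discrete_action (L : QQ -> R) (q : discrete_path) : R :=
  \sum_(k < N) L (q (inord k), q (inord k.+1)).

Definition variation (q : discrete_path) := forall k, tangent (q k).

(* The differential of the function [discrete_action L] on Q^(N+1) at q, in the
   product of the preferred charts around the q k; the k-th row of X holds the
   coordinates of the k-th point. *)
Definition d_discrete_action (L : QQ -> R) (q : discrete_path)
    (dq : variation q) : R :=
  'd (fun X : 'M[R]_(N.+1, n) =>
        discrete_action L (fun k => bwd (chart_around (q k)) (row k X)) : R^o)
     (\matrix_k fwd (chart_around (q k)) (q k))
     (\matrix_k (dq k : 'rV[R]_n)).

Definition is_trajectory (S : dsocs) (q : discrete_path) : Prop :=
  [/\ (2 <= N)%N,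
      forall k, (0 < k < N)%N ->
        subset_of (DK S) (q (inord k.-1), q (inord k), q (inord k.+1)) &
      forall dq : variation q,
        dq ord0 = 0 -> dq ord_max = 0 ->
        (forall k, (0 < k < N)%N ->
           fiber (DV S) (q (inord k.-1)) (q (inord k)) (q (inord k.+1))
                 (dq (inord k))) ->
        d_discrete_action (Ld S) dq = 0].

End Trajectory.

Definition path3 (q0 q1 q2 : Q) : discrete_path 2 := tnth [tuple q0; q1; q2].

(* The target of [flow] is the submanifold F(C_d), as [flow] is onto. *)
Record discrete_flow (S : dsocs) := DiscreteFlow {
  Cd : submanifold QQ;
  FCd : submanifold QQ;
  flow : Cd -> FCd;
  flow_diffeo : diffeomorphism flow;
  flow_nontrivial : exists (q0 q1 q2 : Q) (c : Cd),
    [/\ is_trajectory S (path3 q0 q1 q2),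
        inclusion Cd c = (q0, q1) & inclusion FCd (flow c) = (q1, q2)];
  flow_shift : forall c : Cd,
    (inclusion FCd (flow c)).1 = (inclusion Cd c).2;
  flow_trajectory : forall c : Cd,
    is_trajectory S (path3 (inclusion Cd c).1 (inclusion Cd c).2
                           (inclusion FCd (flow c)).2) }.

Definition D1 (L : QQ -> R) (x : QQ) : cotangent x.1 :=
  differential (fun q : Q => L (q, x.2)) x.1.

Definition D2 (L : QQ -> R) (x : QQ) : cotangent x.2 :=
  differential (fun q : Q => L (x.1, q)) x.2.

Definition legendre_minus (L : QQ -> R) (x : QQ) : cotangent_bundle Q :=
  existT _ x.1 (\- D1 L x : cotangent x.1).

Definition legendre_plus (L : QQ -> R) (x : QQ) : cotangent_bundle Q :=
  existT _ x.2 (D2 L x).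

Definition theta_minus (L : QQ -> R) : field1 QQ :=
  fun x v => projT2 (legendre_minus L x) v.1.

Definition theta_plus (L : QQ -> R) : field1 QQ :=
  fun x v => projT2 (legendre_plus L x) v.2.

(* d theta^+ = d theta^- since theta^+ - theta^- = dL. *)
Definition Omega (L : QQ -> R) : field2 QQ :=
  fun x u v => - ext_d (theta_plus L) x u v.

End Discrete.

Arguments fiber {R n Q} D q q' q'' _.
Arguments Omega {R n Q} L x u v.

(* Main.v *)
Require Import Defs.
From HB Require Import structures.
From mathcomp Require Import all_boot all_order all_algebra.
From mathcomp Require Import all_classical all_reals all_analysis.
From mathcomp Require Import ring.
Set Implicit Arguments.
Unset Strict Implicit.
Unset Printing Implicit Defensive.
Import Order.TTheory GRing.Theory Num.Theory.
Import numFieldNormedType.Exports.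
Local Open Scope classical_set_scope.
Local Open Scope ring_scope.

(** The flow F has the shift property: the first component of F(q0, q1) is q1.
    Let i_C and i_F be the two inclusions into Q x Q.  Differentiating the shift
    property, the first component of T(i_F o F) w is the second component of
    T(i_C) w ([tangent_flow_shift]).  As theta^- reads off first components and
    theta^+ second components, this says that

      xi = i_C^* theta^+ - F^* i_F^* theta^-.

    The theorem is then formal: d is linear, commutes with pullbacks, and
    d theta^- = d theta^+ = - Omega.

    Two facts carry the formal part.  First, pulling back along a smooth map
    preserves 1-forms and commutes with d ([is_form1_pullback1],
    [ext_d_pullback1]).  In charts, a form is a function b(y, w) smooth in y and
    linear in w, and its pullback by phi is b(phi z, D_v phi z).  The derivative
    of the latter along u is the derivative of b along D_u phi plus the term
    b(phi z, D_u D_v phi z), and antisymmetrizing in u and v kills the second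
    term because second derivatives commute ([derive_comm]).  Second,
    theta^- = theta^+ - dL, where dL is closed, again by [derive_comm]
    ([ext_d_theta_minus]).

    Smoothness means that iterated directional derivatives along constant
    vectors stay differentiable.  Its stability under composition is proved by
    induction on the order of differentiability ([diff_order]): in a space with
    finitely many coordinates, the derivative of g o f along v is the sum of
    the products of the coordinates of D_v f with the derivatives of g along
    the basis vectors, composed with f, all of which have one order less. *)

(** * Derivatives and coordinates *)

Lemma open_near {T : topologicalType} (U : set T) (P : T -> Prop) (x : T) :
  open U -> U x -> (forall y, U y -> P y) -> \forall y \near x, P y.
Proof.
by move=> oU Ux UP; apply: filterS UP _; exact: open_nbhs_nbhs.
Qed.

Lemma near_eq_diff {R : realType} {E F : normedModType R} (f g : E -> F)
    (x : E) :
  {near x, f =1 g} -> differentiable f x -> 'd f x =1 'd g x.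
Proof.
move=> fg df v.
rewrite -(deriveE _ df) -(deriveE _ (near_eq_differentiable fg df)).
exact: near_eq_derive.
Qed.

Lemma derive_comp {R : realType} {E F G : normedModType R} (f : E -> F)
    (g : F -> G) (x v : E) :
  differentiable f x -> differentiable g (f x) ->
  'D_v (g \o f) x = 'D_('D_v f x) g (f x).
Proof.
move=> df dg; rewrite (deriveE _ (differentiable_comp df dg)).
by rewrite (diff_comp df dg) /= (deriveE _ df) (deriveE _ dg).
Qed.

(** Finite dimensionality, as a finite family of vectors with continuous
    coordinate functions.  It lets a derivative of g along the moving direction
    D_v f be expanded into derivatives of g along fixed directions. *)
Definition has_coordinates {R : realType} (E : normedModType R) : Prop :=
  exists (I : finType) (b : I -> E) (l : I -> {linear E -> R^o}),
    (forall i, continuous (l i)) /\ forall x, x = \sum_i l i x *: b i.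

Lemma has_coordinates_R {R : realType} :
  has_coordinates (R^o : normedModType R).
Proof.
exists unit, (fun=> 1), (fun=> idfun : {linear R^o -> R^o}); split=> [_ x|x].
  exact: cvg_id.
by rewrite big_const card_unit /= addr0 [RHS]mulr1.
Qed.

Lemma has_coordinates_rV {R : realType} (n : nat) :
  has_coordinates ('rV[R]_n : normedModType R).
Proof.
have lin (j : 'I_n) : linear (fun u : 'rV[R]_n => u 0 j : R^o).
  by move=> a u v; rewrite !mxE.
pose l (j : 'I_n) : {linear 'rV[R]_n -> R^o} :=
  HB.pack (fun u : 'rV[R]_n => u 0 j : R^o)
    (GRing.isLinear.Build _ _ _ _ _ (lin j)).
exists 'I_n, (fun j => 'e_j), l; split=> [j|x]; first exact: coord_continuous.
exact: row_sum_delta.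
Qed.

Lemma has_coordinates_prod {R : realType} (E F : normedModType R) :
  has_coordinates E -> has_coordinates F ->
  has_coordinates (E * F)%type.
Proof.
move=> [I [b [l [cl lE]]]] [J [c [m [cm mE]]]].
have linl i : linear (fun p : E * F => l i p.1).
  by move=> a u v; rewrite /= linearP.
have linm j : linear (fun p : E * F => m j p.2).
  by move=> a u v; rewrite /= linearP.
pose k (s : I + J) : {linear (E * F)%type -> R^o} :=
  match s with
  | inl i => HB.pack (fun p : E * F => l i p.1)
      (GRing.isLinear.Build _ _ _ _ _ (linl i))
  | inr j => HB.pack (fun p : E * F => m j p.2)
      (GRing.isLinear.Build _ _ _ _ _ (linm j))
  end.
exists (I + J)%type,
  (fun s => match s with inl i => (b i, 0) | inr j => (0, c j) end), k; split.
  case=> [i|j] p /=.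
    by apply: (@cvg_comp _ _ _ fst (l i) _ (nbhs p.1)); [exact: cvg_fst|exact: cl].
  by apply: (@cvg_comp _ _ _ snd (m j) _ (nbhs p.2)); [exact: cvg_snd|exact: cm].
move=> [x y]; rewrite big_sumType /=.
have -> : \sum_i l i x *: ((b i, 0) : E * F) = (x, 0).
  rewrite [in RHS](lE x).
  apply: (big_ind2 (fun (p : E * F) u => p = (u, 0))) => // [_ u _ v -> ->|i _].
    by congr pair; rewrite /= addr0.
  by congr pair; rewrite /= scaler0.
have -> : \sum_j m j y *: ((0, c j) : E * F) = (0, y).
  rewrite [in RHS](mE y).
  apply: (big_ind2 (fun (p : E * F) u => p = (0, u))) => // [_ u _ v -> ->|j _].
    by congr pair; rewrite /= addr0.
  by congr pair; rewrite /= scaler0.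
by congr pair; rewrite /= ?addr0 ?add0r.
Qed.

Lemma derive_linear_comp {R : realType} {E F : normedModType R} (f : E -> F)
    (l : {linear F -> R^o}) (x v : E) :
  continuous l -> differentiable f x ->
  'D_v (l \o f) x = l ('D_v f x).
Proof.
move=> cl df; have dl := linear_differentiable (f x) cl.
by rewrite (derive_comp _ df dl) (deriveE _ dl) (diff_lin _ cl).
Qed.

(** * Smoothness *)

(** Smoothness truncated at order k.  The recursion takes off the derivative
    that is applied first to f, whereas [iter_derive] takes off the last one;
    this is the form in which an induction on k can use the formulas for the
    derivative of a sum, a product or a composite. *)
Fixpoint diff_order {R : realType} {E F : normedModType R} (k : nat)
    (U : set E) (f : E -> F) : Prop :=
  (forall x, U x -> differentiable f x) /\
  if k is k'.+1 then forall v, diff_order k' U ('D_v f) else True.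

Lemma iter_derive_rcons {R : realType} {E F : normedModType R} (vs : seq E)
    (v : E) (f : E -> F) :
  iter_derive (rcons vs v) f = iter_derive vs ('D_v f).
Proof. by elim: vs => //= w vs ->. Qed.

Lemma smooth_on_diff_order {R : realType} {E F : normedModType R} (U : set E)
    (f : E -> F) :
  smooth_on U f <-> forall k, diff_order k U f.
Proof.
split=> [sf k|df vs].
  elim: k f sf => [|k IH] f sf /=.
    by split=> // x Ux; exact: (sf [::]).
  split=> [x Ux|v]; first exact: (sf [::]).
  by apply: IH => vs x Ux; rewrite -iter_derive_rcons; exact: sf.
have : diff_order (size vs) U f by [].
elim/last_ind: vs f {df} => [|vs v IH] f /=; first by case.
rewrite size_rcons iter_derive_rcons => -[_ /(_ v)].
exact: IH.
Qed.

Lemma smooth_on_derive {R : realType} {E F : normedModType R} (U : set E)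
    (f : E -> F) (v : E) : smooth_on U f -> smooth_on U ('D_v f).
Proof. by move=> sf vs x; rewrite -iter_derive_rcons; exact: sf. Qed.

Section DiffOrder.
Context {R : realType} {E : normedModType R}.
Variable U : set E.
Hypothesis oU : open U.

Lemma eq_diff_order {F : normedModType R} k (f g : E -> F) :
  (forall x, U x -> f x = g x) -> diff_order k U f -> diff_order k U g.
Proof.
elim: k f g => [|k IH] f g fg /= [df kf].
  split=> // x Ux; apply: near_eq_differentiable (df x Ux).
  exact: open_near Ux fg.
split=> [x Ux|v].
  by apply: near_eq_differentiable (df x Ux); exact: open_near Ux fg.
by apply: IH (kf v) => x Ux; apply: near_eq_derive; exact: open_near Ux fg.
Qed.

Lemma diff_orderW {F : normedModType R} k (f : E -> F) :
  diff_order k.+1 U f -> diff_order k U f.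
Proof.
elim: k f => [|k IH] f /= [df kf]; first by split.
by split=> // v; apply: IH.
Qed.

Lemma diff_order_cst {F : normedModType R} k (a : F) :
  diff_order k U (fun _ => a).
Proof.
elim: k a => [|k IH] a /=; first by split=> // x _; exact: differentiable_cst.
split=> [x _|v]; first exact: differentiable_cst.
by apply: eq_diff_order (IH 0) => x Ux; rewrite derive_cst.
Qed.

Lemma diff_orderD {F : normedModType R} k (f g : E -> F) :
  diff_order k U f -> diff_order k U g -> diff_order k U (f + g).
Proof.
elim: k f g => [|k IH] f g /= [df kf] [dg kg].
  by split=> [x Ux|]; [exact: differentiableD (df x Ux) (dg x Ux)|].
split=> [x Ux|v]; first exact: differentiableD (df x Ux) (dg x Ux).
apply: eq_diff_order (IH _ _ (kf v) (kg v)) => x Ux.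
by rewrite deriveD//; apply: diff_derivable; [exact: df|exact: dg].
Qed.

Lemma diff_order_sum {F : normedModType R} k (I : finType) (f : I -> E -> F) :
  (forall i, diff_order k U (f i)) ->
  diff_order k U (fun x => \sum_i f i x).
Proof.
move=> kf; rewrite -[X in diff_order _ _ X]fct_sumE.
elim/big_ind : _ => // [|g h]; first exact: diff_order_cst.
exact: diff_orderD.
Qed.

Lemma diff_orderM k (f g : E -> R^o) :
  diff_order k U f -> diff_order k U g ->
  diff_order k U (fun x => f x * g x : R^o).
Proof.
elim: k f g => [|k IH] f g [df kf] [dg kg].
  by split=> [x Ux|]; [exact: differentiableM (df x Ux) (dg x Ux)|].
split=> [x Ux|v]; first exact: differentiableM (df x Ux) (dg x Ux).
have kf' : diff_order k U f by apply: diff_orderW; split.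
have kg' : diff_order k U g by apply: diff_orderW; split.
apply: eq_diff_order (diff_orderD (IH _ _ kf' (kg v)) (IH _ _ kg' (kf v))).
move=> x Ux; rewrite [RHS]deriveM//; apply: diff_derivable.
  exact: df.
exact: dg.
Qed.

Lemma diff_order_linear {F : normedModType R} k (l : {linear F -> R^o})
    (f : E -> F) :
  continuous l -> diff_order k U f -> diff_order k U (l \o f).
Proof.
move=> cl; have dl y := linear_differentiable y cl.
elim: k f => [|k IH] f [df kf].
  by split=> [x Ux|]; [exact: differentiable_comp (df x Ux) (dl _)|].
split=> [x Ux|v]; first exact: differentiable_comp (df x Ux) (dl _).
apply: eq_diff_order (IH _ (kf v)) => x Ux.
by rewrite [RHS]derive_linear_comp//; exact: df.
Qed.

Lemma diff_order_comp {F : normedModType R} (V : set F) k (f : E -> F)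
    (g : F -> R^o) :
  has_coordinates F -> (forall x, U x -> V (f x)) ->
  diff_order k U f -> diff_order k V g -> diff_order k U (g \o f).
Proof.
move=> [I [b [l [cl lE]]]] UV; elim: k f g UV => [|k IH] f g UV [df kf] [dg kg].
  by split=> [x Ux|]; [exact: differentiable_comp (df x Ux) (dg _ (UV x Ux))|].
split=> [x Ux|v].
  exact: differentiable_comp (df x Ux) (dg _ (UV x Ux)).
have kf' : diff_order k U f by apply: diff_orderW; split.
apply: (@eq_diff_order _ _
  (fun x => \sum_i (l i \o 'D_v f) x * ('D_(b i) g \o f) x : R^o)).
  move=> x Ux; have dgx := dg _ (UV _ Ux).
  rewrite derive_comp//; last exact: df.
  rewrite [RHS]deriveE// [in RHS](lE ('D_v f x)) linear_sum.
  by apply: eq_bigr => i _; rewrite linearZ /= -deriveE.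
apply: diff_order_sum => i; apply: diff_orderM.
  exact: diff_order_linear (cl i) (kf v).
exact: IH _ _ UV kf' (kg (b i)).
Qed.

End DiffOrder.

Lemma smooth_on_comp {R : realType} {E F : normedModType R} (U : set E)
    (V : set F) (f : E -> F) (g : F -> R^o) :
  has_coordinates F -> open U -> (forall x, U x -> V (f x)) ->
  smooth_on U f -> smooth_on V g -> smooth_on U (g \o f).
Proof.
move=> cF oU UV /smooth_on_diff_order sf /smooth_on_diff_order sg.
by apply/smooth_on_diff_order => k; exact: diff_order_comp (sf k) (sg k).
Qed.

Lemma eq_smooth_on {R : realType} {E F : normedModType R} (U : set E)
    (f g : E -> F) :
  open U -> (forall x, U x -> f x = g x) -> smooth_on U f -> smooth_on U g.
Proof.
move=> oU fg /smooth_on_diff_order sf; apply/smooth_on_diff_order => k.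
exact: eq_diff_order (sf k).
Qed.

Lemma smooth_onB {R : realType} {E : normedModType R} (U : set E)
    (f g : E -> R^o) :
  open U -> smooth_on U f -> smooth_on U g ->
  smooth_on U (fun x => f x - g x : R^o).
Proof.
move=> oU /smooth_on_diff_order sf /smooth_on_diff_order sg.
apply/smooth_on_diff_order => k.
have := diff_orderD oU (sf k)
  (diff_orderM oU (diff_order_cst oU k (-1 : R^o)) (sg k)).
by apply: eq_diff_order => // x _; rewrite !fctE mulN1r.
Qed.

(** * Symmetry of second derivatives *)

Lemma derive_line {R : realType} {E F : normedModType R} (f : E -> F)
    (p u : E) (s : R) :
  differentiable f (p + s *: u) ->
  is_derive s 1 (fun t : R => f (p + t *: u)) ('D_u f (p + s *: u)).
Proof.
move=> df; pose g (t : R) := p + t *: u.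
have dg : is_diff s g (fun t => 0 + t *: u) by apply: is_diffD.
have dfg : differentiable (f \o g) s by apply: differentiable_comp.
apply: DeriveDef; first exact: diff_derivable.
rewrite [LHS]derive_comp //; congr ('D__ f _).
by rewrite deriveE// diff_val add0r scale1r.
Qed.

Definition second_difference {R : realType} {E : normedModType R}
    (f : E -> R^o) (x u v : E) (h : R) : R :=
  (f (x + h *: v + h *: u) - f (x + h *: u)) - (f (x + h *: v) - f x).

(** This symmetry is the reason why second derivatives commute: the second
    difference does not see the order of u and v, while its approximation below
    does. *)
Lemma second_differenceC {R : realType} {E : normedModType R} (f : E -> R^o)
    (x u v : E) (h : R) :
  second_difference f x u v h = second_difference f x v u h.
Proof.
rewrite /second_difference [x + h *: v + _]addrAC.
move: (f _) (f _) (f _) (f _) => a b c d.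
ring.
Qed.

(** The second difference is k(h) - k(0) for k(s) = f(x+hv+su) - f(x+su), so by
    the mean value theorem it equals h (D_u f(x+hv+su) - D_u f(x+su)) for some s
    between 0 and h.  Both points are within O(h) of x, where D_u f is
    approximated by its affine part up to o(h); the affine parts differ by
    h D_v D_u f(x). *)
Lemma second_difference_approx {R : realType} {E : normedModType R}
    (f : E -> R^o) (x u v : E) (e : R) :
  (\forall y \near x, differentiable f y) -> differentiable ('D_u f) x ->
  0 < e ->
  \forall h \near 0^'+,
    `|second_difference f x u v h - h ^+ 2 * 'D_v ('D_u f) x| <= e * h ^+ 2.
Proof.
move=> dfx dg e0; set g := 'D_u f in dg *.
(* C h bounds the sum of the distances to x of the two points x+hv+su and
   x+su at which D_u f is evaluated; the summand 1 makes C positive. *)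
pose C := 2 * `|u| + `|v| + 1.
have C0 : 0 < C by rewrite ltr_wpDl// addr_ge0// mulr_ge0.
have eC0 : 0 < e / C by rewrite divr_gt0.
have := (eqaddoP _ _ _ _).1 (diff_locally dg) _ eC0.
have : \forall w \near (0 : E), differentiable f (w + x).
  by move: dfx; rewrite (near_shift 0 x) subr0.
move=> n1 n2; have [r /= r0 nr] := (nbhs_ballP _ _).1 (filterI n1 n2).
near=> h.
have h0 : 0 < h by [].
have hr : h * C < r.
  by rewrite -ltr_pdivlMr//; near: h; apply: nbhs_right_lt; rewrite divr_gt0.
have ball_r w : `|w| <= h * C -> differentiable f (w + x) /\
    `|g (w + x) - (g x + 'd g x w)| <= e / C * `|w|.
  move=> wr; have [//|dfw gw] := nr w.
    by rewrite -ball_normE /= sub0r normrN (le_lt_trans wr).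
  by split=> //; move: gw; rewrite !fctE /=.
have nsu s : 0 <= s <= h -> `|s *: u| <= h * `|u|.
  by move=> /andP[s0 sh]; rewrite normrZ ger0_norm// ler_wpM2r.
have nhv : `|h *: v| = h * `|v| by rewrite normrZ gtr0_norm.
pose k (s : R) := f (x + h *: v + s *: u) - f (x + s *: u).
have w1 s : 0 <= s <= h -> `|h *: v + s *: u| <= h * (`|u| + `|v|).
  by move=> sh; rewrite (le_trans (ler_normD _ _))// nhv mulrDr addrC lerD2r nsu.
have w1C s : 0 <= s <= h -> `|h *: v + s *: u| <= h * C.
  move=> /w1/le_trans; apply; rewrite ler_pM2l// /C.
  by rewrite -addrA mulr2n mulrDl mul1r -addrA lerD2l addrA ler_wpDr// ler_wpDl.
have w2C s : 0 <= s <= h -> `|s *: u| <= h * C.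
  move=> /nsu/le_trans; apply; rewrite ler_pM2l// /C.
  by rewrite mulr2n mulrDl mul1r -!addrA lerDl !addr_ge0.
have dk s : 0 <= s <= h -> is_derive s 1 k
    (g (x + h *: v + s *: u) - g (x + s *: u)).
  move=> sh; apply: is_deriveB; apply: derive_line.
    by rewrite -addrA addrC; have [] := ball_r _ (w1C s sh).
  by rewrite addrC; have [] := ball_r _ (w2C s sh).
have [s] : exists2 s, s \in `]0, h[%R & k h - k 0 =
    (g (x + h *: v + s *: u) - g (x + s *: u)) * (h - 0).
  apply: (@MVT _ k (fun s => g (x + h *: v + s *: u) - g (x + s *: u))) => //.
    by move=> s; rewrite in_itv /= => /andP[s0 sh]; apply: dk; rewrite !ltW.
  apply: derivable_within_continuous => s; rewrite in_itv /= => sh.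
  by have [] := dk s sh.
rewrite in_itv /= => /andP[/ltW s0 /ltW sh].
have sI : 0 <= s <= h by rewrite s0.
rewrite subr0 {1 2}/k !scale0r !addr0 -/(second_difference f x u v h) => ->.
have [_ g1] := ball_r _ (w1C s sI).
have [_ g2] := ball_r _ (w2C s sI).
rewrite deriveE//.
have -> : (g (x + h *: v + s *: u) - g (x + s *: u)) * h - h ^+ 2 * 'd g x v =
  h * ((g (h *: v + s *: u + x) - (g x + 'd g x (h *: v + s *: u)))
       - (g (s *: u + x) - (g x + 'd g x (s *: u)))).
  have -> : 'd g x (h *: v + s *: u) = h * 'd g x v + 'd g x (s *: u).
    by rewrite linearD linearZ.
  rewrite -[x + _ + _]addrA ![x + _]addrC.
  move: (g _) (g _) (g _) ('d g x _) ('d g x _) => a b c i j.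
  ring.
rewrite normrM gtr0_norm// expr2 mulrCA ler_pM2l//.
rewrite (le_trans (ler_normB _ _))// (le_trans (lerD g1 g2))//.
rewrite -mulrDr mulrAC ler_pdivrMr// -mulrA ler_pM2l//.
rewrite (le_trans (lerD (w1 s sI) (nsu s sI)))// -mulrDr ler_pM2l// /C.
by rewrite mulr2n mulrDl mul1r [_ + _ + `|u|]addrAC ler_wpDr.
Unshelve. all: by end_near. Qed.

(** Symmetry of second derivatives (Schwarz).  It is reduced to real valued
    functions by taking coordinates; there, both sides are the limit of the
    second difference divided by h^2. *)
Lemma derive_comm {R : realType} {E F : normedModType R} (f : E -> F)
    (x u v : E) :
  has_coordinates F ->
  (\forall y \near x, differentiable f y) ->
  differentiable ('D_u f) x -> differentiable ('D_v f) x ->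
  'D_v ('D_u f) x = 'D_u ('D_v f) x.
Proof.
move=> [I [b [l [cl lE]]]] df dfu dfv.
suff lC i : l i ('D_v ('D_u f) x) = l i ('D_u ('D_v f) x).
  rewrite (lE ('D_v ('D_u f) x)) (lE ('D_u ('D_v f) x)).
  by apply: eq_bigr => i _; rewrite lC.
pose fi := l i \o f.
have dl y := linear_differentiable y (cl i).
have dfi : \forall y \near x, differentiable fi y.
  by apply: filterS df => y dfy; exact: differentiable_comp.
have fiE w : \forall y \near x, (l i \o 'D_w f) y = 'D_w fi y.
  by apply: filterS df => y dfy; rewrite /fi derive_linear_comp.
have dfiw w : differentiable ('D_w f) x -> differentiable ('D_w fi) x.
  move=> d; apply: (near_eq_differentiable (fiE w)).
  exact: differentiable_comp.
have lE2 w w' : differentiable ('D_w f) x ->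
    l i ('D_w' ('D_w f) x) = 'D_w' ('D_w fi) x.
  by move=> d; rewrite -derive_linear_comp//; apply: near_eq_derive (fiE w).
rewrite (lE2 _ _ dfu) (lE2 _ _ dfv); apply/eqP; rewrite -subr_eq0 -normr_le0.
apply/ler_addgt0Pl => e e0; rewrite addr0.
have e20 : 0 < e / 2 by rewrite divr_gt0.
have n1 := second_difference_approx v dfi (dfiw _ dfu) e20.
have n2 := second_difference_approx u dfi (dfiw _ dfv) e20.
near (0 : R)^'+ => h.
have h0 : 0 < h by [].
have [h1 h2] :
    `|second_difference fi x u v h - h ^+ 2 * 'D_v ('D_u fi) x| <=
      e / 2 * h ^+ 2 /\
    `|second_difference fi x v u h - h ^+ 2 * 'D_u ('D_v fi) x| <=
      e / 2 * h ^+ 2.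
  near: h; exact: (filterI n1 n2).
have hh : 0 < h ^+ 2 by rewrite exprn_gt0.
rewrite -(ler_pM2r hh) [e in leRHS]splitr [leRHS]mulrDl.
apply: le_trans (lerD h2 h1).
rewrite -{1}(gtr0_norm hh) -normrM second_differenceC.
apply: le_trans (ler_normB _ _); rewrite le_eqVlt; apply/orP; left; apply/eqP.
congr (`| _ |).
move: (second_difference _ _ _ _ _) ('D_v _ x) ('D_u _ x) => a c d.
ring.
Unshelve. all: by end_near. Qed.

(** * Functions linear in their second argument *)

Lemma linear_coordinates {R : realType} {F : normedModType R} (I : finType)
    (b : I -> F) (l : I -> {linear F -> R^o}) (m : F -> R^o) :
  (forall x, x = \sum_i l i x *: b i) -> linear m ->
  forall x, m x = \sum_i l i x * m (b i).
Proof.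
move=> lE lm x.
pose m' : {linear F -> R^o} := HB.pack m (GRing.isLinear.Build _ _ _ _ _ lm).
rewrite [in LHS](lE x) -[m]/(m' : F -> R^o) linear_sum.
by apply: eq_bigr => i _; rewrite linearZ.
Qed.

(** In this lemma and in [derive_field], b stands for the expression of a 1-form
    in a chart, evaluated at the point f x on the vector g x.  Linearity in the
    vector allows both proofs to expand it as the sum over i of
    l_i (g x) * b (f x) (e_i). *)
Lemma smooth_on_field {R : realType} {E F : normedModType R} (U : set E)
    (V : set F) (b : F -> F -> R^o) (f g : E -> F) :
  has_coordinates F -> open U -> (forall x, U x -> V (f x)) ->
  (forall y, linear (b y)) -> (forall w, smooth_on V (b ^~ w)) ->
  smooth_on U f -> smooth_on U g -> smooth_on U (fun x => b (f x) (g x)).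
Proof.
move=> cF oU UV lb sb sf sg.
have [I [e [l [cl lE]]]] := cF.
apply: (@eq_smooth_on _ _ _ _
  (fun x => \sum_i (l i \o g) x * ((b ^~ (e i)) \o f) x : R^o)) => //.
  by move=> x _; rewrite (linear_coordinates lE (lb (f x))).
apply/smooth_on_diff_order => k; apply: diff_order_sum => // i.
apply: diff_orderM => //.
  by apply: diff_order_linear => //; move/smooth_on_diff_order: sg.
by move: k; apply/smooth_on_diff_order; exact: smooth_on_comp (sb (e i)).
Qed.

Lemma derive_field {R : realType} {E F : normedModType R} (b : F -> F -> R^o)
    (f g : E -> F) (x u : E) :
  has_coordinates F -> (forall y, linear (b y)) ->
  (forall w, differentiable (b ^~ w) (f x)) ->
  differentiable f x -> differentiable g x ->
  'D_u (fun z => b (f z) (g z)) x =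
  'D_('D_u f x) (b ^~ (g x)) (f x) + b (f x) ('D_u g x).
Proof.
move=> [I [e [l [cl lE]]]] lb db df dg.
pose h i : E -> R^o := (l i \o g) * ((b ^~ (e i)) \o f).
have dl i y := linear_differentiable y (cl i).
have dlg i : differentiable (l i \o g) x := differentiable_comp dg (dl i _).
have dbf i : differentiable ((b ^~ (e i)) \o f) x :=
  differentiable_comp df (db (e i)).
have bE y w := linear_coordinates lE (lb y) w.
have dh i : is_derive x u (h i)
    (l i (g x) * 'D_('D_u f x) (b ^~ (e i)) (f x) +
     l i ('D_u g x) * b (f x) (e i)).
  apply: DeriveDef; first exact/diff_derivable/differentiableM.
  rewrite /h deriveM; [|exact: diff_derivable..].
  rewrite (derive_comp _ df (db (e i))) derive_linear_comp//.
  by rewrite /GRing.scale /= [X in _ + X]mulrC.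
have -> : (fun z => b (f z) (g z)) = \sum_i h i.
  by apply/funext => z; rewrite fct_sumE bE.
transitivity (\sum_i (l i (g x) * 'D_('D_u f x) (b ^~ (e i)) (f x) +
     l i ('D_u g x) * b (f x) (e i))).
  suff : is_derive x u (\sum_i h i) (\sum_i (l i (g x) *
      'D_('D_u f x) (b ^~ (e i)) (f x) + l i ('D_u g x) * b (f x) (e i))).
    by move=> ?; rewrite derive_val.
  elim/big_ind2 : _ => // [|? ? ? ? ? ?]; first exact: is_derive_cst.
  exact: is_deriveD.
rewrite big_split /= -bE; congr (_ + _).
set w := 'D_u f x.
have -> : b ^~ (g x) = \sum_i (fun y => l i (g x) * b y (e i)).
  by apply/funext => y; rewrite fct_sumE bE.
suff di : is_derive (f x) w (\sum_i (fun y => l i (g x) * b y (e i) : R^o))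
    (\sum_i l i (g x) * 'D_w (b ^~ (e i)) (f x)) by rewrite derive_val.
elim/big_ind2 : _ => // [|? ? ? ? ? ?|i _]; first exact: is_derive_cst.
  exact: is_deriveD.
apply: (@is_deriveZ _ _ _ (b ^~ (e i))).
exact/derivableP/diff_derivable.
Qed.

(** * Maps in charts *)

(** The expression of f in the preferred charts around x and y.  The identity is
    allowed for f, so that transition maps are covered as well. *)
Definition local_rep {R : realType} {E F : normedModType R} (M : manifold E)
    (N : manifold F) (f : M -> N) (x : M) (y : N) : E -> F :=
  fwd (chart_around y) \o f \o bwd (chart_around x).

Lemma near_bwd {R : realType} {X : topologicalType} {E : normedModType R}
    (c : chart X E) (A : set X) (p : X) :
  open A -> dom c p -> A p ->
  \forall z \near fwd c p, A (bwd c z).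
Proof.
move=> oA cp Ap; apply: (@bwd_cont _ _ _ c); first by exists p.
by rewrite fwdK//; exact: open_nbhs_nbhs.
Qed.

Lemma near_chart {R : realType} {X : topologicalType} {E : normedModType R}
    (c : chart X E) (p : X) (P : E -> Prop) :
  dom c p -> (forall q, dom c q -> P (fwd c q)) -> \forall z \near fwd c p, P z.
Proof.
move=> cp cP; apply: (open_near (cod_open c)); first by exists p.
by move=> _ [q cq <-]; exact: cP.
Qed.

Lemma smooth_map_id {R : realType} {E : normedModType R} (M : manifold E) :
  smooth_map (id : M -> M).
Proof. split=> [z|x y]; first exact: cvg_id.
exact: (@chart_compat _ _ _ (structure_of M) x y).
Qed.

Section Maps.
Context {R : realType} {E F : normedModType R}.
Variables (M : manifold E) (N : manifold F) (f : M -> N).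
Hypothesis sf : smooth_map f.

Lemma open_preimage (A : set N) : open A -> open (f @^-1` A).
Proof. by move: A; apply/continuousP; case: sf. Qed.

Lemma local_rep_differentiable (x : M) (y : N) (p : M) :
  dom (chart_around x) p -> dom (chart_around y) (f p) ->
  differentiable (local_rep f x y) (fwd (chart_around x) p).
Proof. by move=> xp yfp; apply: (sf.2 x y [::]); exists p. Qed.

Lemma near_local_rep {W : Type} (h : N -> W) (x : M) (y : N) (p : M) :
  dom (chart_around x) p -> dom (chart_around y) (f p) ->
  {near fwd (chart_around x) p,
    (h \o bwd (chart_around y)) \o local_rep f x y =1
      h \o f \o bwd (chart_around x)}.
Proof.
move=> xp yfp.
have := near_bwd (open_preimage (dom_open (chart_around y))) xp yfp.
by apply: filterS => z /= yz; rewrite /local_rep /= fwdK.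
Qed.

Lemma local_rep_fwd (x : M) (y : N) (p : M) :
  dom (chart_around x) p ->
  local_rep f x y (fwd (chart_around x) p) = fwd (chart_around y) (f p).
Proof. by move=> xp; rewrite /local_rep /= fwdK. Qed.

(** The chain rule in charts.  The equality of h o f with the composite of the
    local expressions only holds near p, because the chart around y need not
    contain the whole image of the chart around x. *)
Lemma diff_chart_comp {W : normedModType R} (h : N -> W) (x : M) (y : N)
    (p : M) :
  dom (chart_around x) p -> dom (chart_around y) (f p) ->
  differentiable (h \o bwd (chart_around y)) (fwd (chart_around y) (f p)) ->
  differentiable (h \o f \o bwd (chart_around x)) (fwd (chart_around x) p) /\
  forall v, 'd (h \o f \o bwd (chart_around x)) (fwd (chart_around x) p) v =
    'd (h \o bwd (chart_around y)) (fwd (chart_around y) (f p))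
       ('d (local_rep f x y) (fwd (chart_around x) p) v).
Proof.
move=> xp yfp; rewrite -(local_rep_fwd y xp) => dh.
have df := local_rep_differentiable xp yfp.
have dhf := differentiable_comp df dh.
have nE := near_local_rep h xp yfp.
split=> [|v]; first exact: near_eq_differentiable nE dhf.
by rewrite -(near_eq_diff nE dhf) (diff_comp df dh).
Qed.

End Maps.

Lemma diff_local_rep_comp {R : realType} {E F G : normedModType R}
    (M : manifold E) (N : manifold F) (P : manifold G) (f : M -> N)
    (g : N -> P) (x : M) (y : N) (z : P) (p : M) :
  smooth_map f -> smooth_map g ->
  dom (chart_around x) p -> dom (chart_around y) (f p) ->
  dom (chart_around z) (g (f p)) ->
  differentiable (local_rep (g \o f) x z) (fwd (chart_around x) p) /\
  forall v, 'd (local_rep (g \o f) x z) (fwd (chart_around x) p) v =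
    'd (local_rep g y z) (fwd (chart_around y) (f p))
       ('d (local_rep f x y) (fwd (chart_around x) p) v).
Proof.
move=> sf sg xp yfp zgfp.
have dg := local_rep_differentiable sg yfp zgfp.
exact: (diff_chart_comp sf xp yfp dg).
Qed.

(** * Differential forms *)

Section Forms.
Context {R : realType} {E : normedModType R}.
Variable M : manifold E.

Lemma in_chartE (c : chart M E) (a : field1 M) (y v : E) (p : M) :
  bwd c y = p ->
  in_chart c a y v = a p ('d (fwd (chart_around p) \o bwd c) y v).
Proof. by move=> <-. Qed.

Lemma in_chart_fwd (x p : M) (a : field1 M) (v : E) :
  dom (chart_around x) p ->
  in_chart (chart_around x) a (fwd (chart_around x) p) v =
  a p ('d (local_rep id x p) (fwd (chart_around x) p) v).
Proof. by move=> xp; rewrite (in_chartE _ _ (fwdK xp)). Qed.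

Lemma in_chart_linear (c : chart M E) (a : field1 M) (y : E) :
  (forall x : M, linear (a x : tangent x -> R^o)) ->
  linear (in_chart c a y : E -> R^o).
Proof. by move=> la k u v; rewrite /in_chart linearP la. Qed.

Lemma is_form1B (a b : field1 M) :
  is_form1 a -> is_form1 b -> is_form1 (fun x v => a x v - b x v : R).
Proof.
move=> [la sa] [lb sb]; split=> [x k u v|x v].
  rewrite la lb /GRing.scale /=.
  by rewrite mulrBr opprD addrACA.
by apply: smooth_onB; [exact: cod_open|exact: sa|exact: sb].
Qed.

Lemma is_form1_derivable (a : field1 M) (x : M) (u v : E) :
  is_form1 a ->
  derivable (fun y => in_chart (chart_around x) a y v)
    (fwd (chart_around x) x) u.
Proof.
move=> [_ sa]; apply: diff_derivable; apply: (sa x v [::]).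
by exists x => //; exact: chart_at_dom.
Qed.

Lemma ext_dB (a b : field1 M) (x : M) (u v : tangent x) :
  is_form1 a -> is_form1 b ->
  ext_d (fun x v => a x v - b x v : R) x u v = ext_d a x u v - ext_d b x u v.
Proof.
move=> fa fb; rewrite /ext_d.
have dB w z : 'D_w (fun y => in_chart (chart_around x)
      (fun x v => a x v - b x v : R) y z) (fwd (chart_around x) x) =
    'D_w (fun y => in_chart (chart_around x) a y z) (fwd (chart_around x) x) -
    'D_w (fun y => in_chart (chart_around x) b y z) (fwd (chart_around x) x).
  rewrite -deriveB//; exact: is_form1_derivable.
rewrite !dB; move: ('D_u _ _) ('D_v _ _) ('D_u _ _) ('D_v _ _) => p q r s.
ring.
Qed.

(** The coordinate expression of dL does not depend on the preferred charts
    around the individual points of the domain: the transition map hidden in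
    [in_chart] and the one hidden in [differential] compose to the identity. *)
Lemma in_chart_differential (L : M -> R) (x p : M) (v : E) :
  smooth_function L -> dom (chart_around x) p ->
  in_chart (chart_around x) (fun q w => differential L q w)
    (fwd (chart_around x) p) v =
  'D_v (L \o bwd (chart_around x) : E -> R^o) (fwd (chart_around x) p).
Proof.
move=> sL xp; have pp := chart_at_dom (structure_of M) p.
have dL : differentiable (L \o bwd (chart_around p) : E -> R^o)
    (fwd (chart_around p) p) by apply: (sL p [::]); exists p.
have [dLx dE] := diff_chart_comp (smooth_map_id M) xp pp dL.
by rewrite in_chart_fwd// deriveE// dE.
Qed.

Lemma is_form1_differential (L : M -> R) :
  smooth_function L -> is_form1 (fun x v => differential L x v).
Proof.
move=> sL; split=> [x k u v|x v]; first by rewrite linearP.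
apply: (@eq_smooth_on _ _ _ _ ('D_v (L \o bwd (chart_around x) : E -> R^o))).
- exact: cod_open.
- by move=> _ [p xp <-]; rewrite in_chart_differential.
- exact/smooth_on_derive/sL.
Qed.

(** In a chart, d(dL)(u, v) is D_u D_v L - D_v D_u L, which vanishes by
    [derive_comm]. *)
Lemma ext_d_differential (L : M -> R) (x : M) (u v : tangent x) :
  smooth_function L -> ext_d (fun x v => differential L x v) x u v = 0.
Proof.
move=> sL; have xx := chart_at_dom (structure_of M) x.
have xI : (fwd (chart_around x) @` dom (chart_around x))
  (fwd (chart_around x) x) by exists x.
have nE w : {near fwd (chart_around x) x,
    (fun y => in_chart (chart_around x) (fun q w => differential L q w) y w) =1
    'D_w (L \o bwd (chart_around x) : E -> R^o)}.
  by apply: near_chart => // q xq; rewrite in_chart_differential.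
apply/eqP; rewrite /ext_d !(near_eq_derive _ (nE _)) subr_eq0; apply/eqP.
apply: derive_comm.
- exact: has_coordinates_R.
- apply: near_chart => // q xq; apply: (sL x [::]); by exists q.
- exact: (sL x [:: v]).
- exact: (sL x [:: u]).
Qed.

End Forms.

Section Pullback.
Context {R : realType} {E F : normedModType R}.
Variables (M : manifold E) (N : manifold F) (f : M -> N).
Hypotheses (cF : has_coordinates F) (sf : smooth_map f).

(** Any chart around f p may be used on the side of N, not only the preferred
    one: both transition maps are absorbed by the chain rule. *)
Lemma in_chart_pullback1 (a : field1 N) (x p : M) (y : N) (v : E) :
  dom (chart_around x) p -> dom (chart_around y) (f p) ->
  let z := fwd (chart_around x) p in
  in_chart (chart_around x) (pullback1 f a) z v =
  in_chart (chart_around y) a (local_rep f x y z) ('D_v (local_rep f x y) z).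
Proof.
move=> xp yfp /=; have pp := chart_at_dom (structure_of M) p.
have qq := chart_at_dom (structure_of N) (f p).
rewrite (deriveE _ (local_rep_differentiable sf xp yfp)) (local_rep_fwd f y xp).
rewrite !in_chart_fwd// /pullback1; congr (a (f p) _).
have [_ <-] := diff_local_rep_comp (smooth_map_id M) sf xp pp qq.
have [_ <-] := diff_local_rep_comp sf (smooth_map_id N) xp yfp qq.
by [].
Qed.

(** Smoothness is local: near each p, the pullback is expressed in the chart
    around f p, where [smooth_on_field] applies. *)
Lemma is_form1_pullback1 (a : field1 N) :
  is_form1 a -> is_form1 (pullback1 f a).
Proof.
move=> [la sa]; split=> [x k u v|x v vs _ [p xp <-]].
  by rewrite /pullback1 linearP la.
have pp := chart_at_dom (structure_of N) (f p).
set c := chart_around x; set d := chart_around (f p).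
pose W := fwd c @` (dom c `&` f @^-1` dom d).
have oW : open W by apply: overlap_open; exact: open_preimage (dom_open d).
suff : smooth_on W (fun z => in_chart c (pullback1 f a) z v).
  by apply; exists p.
pose phi := local_rep f x (f p).
apply: (@eq_smooth_on _ _ _ _
  (fun z => in_chart d a (phi z) ('D_v phi z))) => //.
  by move=> _ [q [xq dq] <-]; rewrite (@in_chart_pullback1 a x q (f p)).
apply: (@smooth_on_field _ _ _ _ (fwd d @` dom d)) => //.
- move=> _ [q [xq dq] <-]; rewrite /phi local_rep_fwd//.
  by exists (f q).
- by move=> y; exact: in_chart_linear.
- exact: sa.
- exact: sf.2.
- by apply: smooth_on_derive; exact: sf.2.
Qed.

(** Differentiating b(phi z, D_v phi z) along u gives the pullback of the
    derivative of b, plus a term in D_u D_v phi which is symmetric in u and v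
    and therefore cancels in the exterior derivative. *)
Lemma ext_d_pullback1 (a : field1 N) (x : M) (u v : tangent x) :
  is_form1 a -> ext_d (pullback1 f a) x u v = pullback2 f (ext_d a) x u v.
Proof.
move=> [la sa]; have xx := chart_at_dom (structure_of M) x.
have yy := chart_at_dom (structure_of N) (f x).
set c := chart_around x; set d := chart_around (f x).
pose phi : E -> F := local_rep f x (f x).
pose W := fwd c @` (dom c `&` f @^-1` dom d).
have oW : open W by apply: overlap_open; exact: open_preimage (dom_open d).
have Wx : W (fwd c x) by exists x.
have sphi : smooth_on W phi := sf.2 x (f x).
have dphi := sphi [::] _ Wx.
have phix : phi (fwd c x) = fwd d (f x) by exact: local_rep_fwd.
have pE (w1 w2 : E) :
    'D_w1 (fun z => in_chart c (pullback1 f a) z w2) (fwd c x) =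
    'D_('D_w1 phi (fwd c x)) (fun y => in_chart d a y ('D_w2 phi (fwd c x)))
      (fwd d (f x)) +
    in_chart d a (fwd d (f x)) ('D_w1 ('D_w2 phi) (fwd c x)).
  have da (w : F) : differentiable (fun y => in_chart d a y w) (phi (fwd c x)).
    by rewrite phix; apply: (sa (f x) w [::]); exists (f x).
  have la' y := in_chart_linear d y la.
  rewrite -phix -(derive_field w1 cF la' da dphi (sphi [:: w2] _ Wx)).
  apply: near_eq_derive; apply: (open_near oW Wx) => _ [q [xq dq] <-].
  exact: in_chart_pullback1.
rewrite /pullback2 /ext_d !pE -/d.
have -> : 'D_u ('D_v phi) (fwd c x) = 'D_v ('D_u phi) (fwd c x).
  apply: derive_comm => //.
  - by apply: (open_near oW Wx) => y Wy; exact: (sphi [::]).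
  - exact: (sphi [:: v]).
  - exact: (sphi [:: u]).
by rewrite !(deriveE _ dphi) opprD addrACA subrr addr0.
Qed.

End Pullback.

(** * Discrete Lagrangian forms *)

Section LagrangianForms.
Context {R : realType} {n : nat} (Q : manifold 'rV[R]_n).
Local Notation QQ := (prod_manifold Q Q).
Variable L : QQ -> R.
Hypothesis sL : smooth_function L.

Let dL (x : QQ) : differentiable (L \o bwd (chart_around x) :
  'rV[R]_n * 'rV[R]_n -> R^o) (fwd (chart_around x) x).
Proof. by apply: (@sL x [::]); exists x => //; exact: chart_at_dom. Qed.

(** The preferred chart around (q, q') is the product chart, so fixing q' is,
    in coordinates, composition with an affine inclusion. *)
Lemma D1E (x : QQ) (w : 'rV[R]_n) :
  D1 L x w = differential L x ((w, 0) : 'rV[R]_n * 'rV[R]_n).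
Proof.
case: x => q q'; set y := fwd (chart_around q) q.
set y' := fwd (chart_around q') q'.
pose h (z : 'rV[R]_n) := (z, y').
have dh : is_diff y h (fun z => (z, 0)) by exact: is_diff_pair.
rewrite /D1 /differential /=.
have -> : (fun p => L (p, q')) \o bwd (chart_around q) =
  (L \o bwd (chart_around ((q, q') : QQ))) \o h.
  by apply/funext => z /=; rewrite fwdK//; exact: chart_at_dom.
have [dhy dhE] := dh.
by rewrite (diff_comp dhy (dL (q, q'))) /= dhE.
Qed.

Lemma D2E (x : QQ) (w : 'rV[R]_n) :
  D2 L x w = differential L x ((0, w) : 'rV[R]_n * 'rV[R]_n).
Proof.
case: x => q q'; set y := fwd (chart_around q) q.
set y' := fwd (chart_around q') q'.
pose h (z : 'rV[R]_n) := (y, z).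
have dh : is_diff y' h (fun z => (0, z)) by exact: is_diff_pair.
rewrite /D2 /differential /=.
have -> : (fun p => L (q, p)) \o bwd (chart_around q') =
  (L \o bwd (chart_around ((q, q') : QQ))) \o h.
  by apply/funext => z /=; rewrite fwdK//; exact: chart_at_dom.
have [dhy dhE] := dh.
by rewrite (diff_comp dhy (dL (q, q'))) /= dhE.
Qed.

Lemma theta_plusE :
  theta_plus L =
  fun x v => differential L x ((0, v.2) : 'rV[R]_n * 'rV[R]_n).
Proof.
by apply/functional_extensionality_dep => x; apply/funext => v; exact: D2E.
Qed.

Lemma theta_minusE :
  theta_minus L =
  fun x v => - differential L x ((v.1, 0) : 'rV[R]_n * 'rV[R]_n).
Proof.
apply/functional_extensionality_dep => x; apply/funext => v.
by rewrite /theta_minus /= D1E.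
Qed.

(** This is theta^+ - theta^- = dL, the reason why both forms have the same
    exterior derivative. *)
Lemma theta_minus_differential :
  theta_minus L = fun x v => theta_plus L v - differential L x v : R.
Proof.
rewrite theta_minusE theta_plusE.
apply/functional_extensionality_dep => x; apply/funext => -[v v'] /=.
have -> : ((v, v') : tangent x) = ((v, 0) : tangent x) + ((0, v') : tangent x).
  by congr pair; rewrite /= ?addr0 ?add0r.
by rewrite linearD opprD addrCA subrr addr0.
Qed.

(** Transition maps between product charts are products of maps, so
    their derivatives commute with the projection of vectors onto the second
    factor. *)
Lemma diff_local_rep_id_snd (x p : QQ) (v : 'rV[R]_n * 'rV[R]_n) :
  dom (chart_around x) p ->
  let T := 'd (local_rep (id : QQ -> QQ) x p) (fwd (chart_around x) p) in
  T (0, v.2) = (0, (T v).2).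
Proof.
case: x p => [x1 x2] [p1 p2] [/= xp1 xp2].
have pp1 := chart_at_dom (structure_of Q) p1.
have pp2 := chart_at_dom (structure_of Q) p2.
have d1 := local_rep_differentiable (smooth_map_id Q) xp1 pp1.
have d2 := local_rep_differentiable (smooth_map_id Q) xp2 pp2.
set y : 'rV[R]_n * 'rV[R]_n :=
  (fwd (chart_around x1) p1, fwd (chart_around x2) p2).
have dT : is_diff y (local_rep (id : QQ -> QQ) (x1, x2) (p1, p2)) (fun w =>
    ('d (local_rep (id : Q -> Q) x1 p1) (y.1) w.1,
     'd (local_rep (id : Q -> Q) x2 p2) (y.2) w.2)).
  apply: is_diff_pair.
    exact: (is_diff_comp (is_diff_fst y) (differentiableP d1)).
  exact: (is_diff_comp (is_diff_snd y) (differentiableP d2)).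
have [_ dE] := dT.
have A0 : 'd (local_rep (id : Q -> Q) x1 p1) (y.1) 0 = 0 by exact: linear0.
by rewrite dE; congr pair; exact: A0.
Qed.

(** Smoothness of theta^+ follows from this: on a constant vector it is, in a
    chart, a directional derivative of L along a constant vector. *)
Lemma in_chart_theta_plus (x p : QQ) (v : 'rV[R]_n * 'rV[R]_n) :
  dom (chart_around x) p ->
  in_chart (chart_around x) (theta_plus L) (fwd (chart_around x) p) v =
  in_chart (chart_around x) (fun q w => differential L q w)
    (fwd (chart_around x) p) (0, v.2).
Proof.
move=> xp; rewrite theta_plusE [LHS]in_chart_fwd// [RHS]in_chart_fwd//.
by rewrite (diff_local_rep_id_snd v xp).
Qed.

Lemma is_form1_theta_plus : is_form1 (theta_plus L).
Proof.
have [ldL sdL] := is_form1_differential sL.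
split=> [x k u v|x v].
  by rewrite /theta_plus /= linearP.
apply: (@eq_smooth_on _ _ _ _ (fun y =>
  in_chart (chart_around x) (fun q w => differential L q w) y (0, v.2))).
- exact: cod_open.
- by move=> _ [p xp <-]; rewrite in_chart_theta_plus.
- exact: sdL.
Qed.

Lemma is_form1_theta_minus : is_form1 (theta_minus L).
Proof.
rewrite theta_minus_differential; apply: is_form1B.
  exact: is_form1_theta_plus.
exact: is_form1_differential.
Qed.

Lemma ext_d_theta_minus (x : QQ) (u v : tangent x) :
  ext_d (theta_minus L) x u v = ext_d (theta_plus L) x u v.
Proof.
rewrite theta_minus_differential ext_dB.
- by rewrite ext_d_differential// subr0.
- exact: is_form1_theta_plus.
- exact: is_form1_differential.
Qed.

End LagrangianForms.

(** The derivative of the identity p_1 o i_F o F = p_2 o i_C. *)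
Lemma tangent_flow_shift {R : realType} {n : nat} (Q : manifold 'rV[R]_n)
    (S : dsocs Q) (Fl : discrete_flow S) (c : Cd Fl) (w : tangent c) :
  (tangent_map (inclusion (FCd Fl)) (flow c)
     (tangent_map (@flow _ _ _ _ Fl) c w)).1 =
  (tangent_map (inclusion (Cd Fl)) c w).2.
Proof.
have sF : smooth_map (@flow _ _ _ _ Fl) by case: (flow_diffeo Fl).
have si := inclusion_smooth (FCd Fl).
have sC := inclusion_smooth (Cd Fl).
have dom1 := chart_at_dom (structure_of (Cd Fl)) c.
have dom2 := chart_at_dom (structure_of (FCd Fl)) (flow c).
have domF := chart_at_dom (structure_of (prod_manifold Q Q))
  (inclusion (FCd Fl) (flow c)).
have domC := chart_at_dom (structure_of (prod_manifold Q Q))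
  (inclusion (Cd Fl) c).
have [dh hE] := diff_local_rep_comp sF si dom1 dom2 domF.
rewrite -[X in X.1 = _]hE.
have dg := local_rep_differentiable sC dom1 domC.
set h := local_rep _ _ _ in dh *; rewrite -/h.
set g := local_rep _ _ _ in dg.
set y := fwd _ _ in dh dg *.
have [dfst fstE] := is_diff_comp (differentiableP dh) (is_diff_fst (h y)).
have [dsnd sndE] := is_diff_comp (differentiableP dg) (is_diff_snd (g y)).
rewrite -[LHS]/((fst \o 'd h y) w) -[RHS]/((snd \o 'd g y) w) -fstE -sndE.
congr ('d _ y w); apply/funext => z.
by rewrite /h /g /local_rep /= !flow_shift.
Qed.

Theorem theorem5p3 (R : realType) (n : nat) (Q : manifold 'rV[R]_n)
    (S : dsocs Q) (Fl : discrete_flow S) (xi : field1 (Cd Fl))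
    (xiE : forall (c : Cd Fl) (w : tangent c),
       let q := inclusion (Cd Fl) c in
       let Fq := inclusion (FCd Fl) (flow c) in
       let dq := tangent_map (inclusion (Cd Fl)) c w in
       xi c w = projT2 (legendre_plus (Ld S) q) dq.2
                - projT2 (legendre_minus (Ld S) Fq) dq.2) :
  is_form1 xi /\
  forall (c : Cd Fl) (u v : tangent c),
    pullback2 (@flow _ _ _ _ Fl)
      (pullback2 (inclusion (FCd Fl)) (Omega (Ld S))) c u v
    = pullback2 (inclusion (Cd Fl)) (Omega (Ld S)) c u v + ext_d xi c u v.
Proof.
have cV := @has_coordinates_rV R n.
have cQ := has_coordinates_prod cV cV.
have sF : smooth_map (@flow _ _ _ _ Fl) by case: (flow_diffeo Fl).
have si := inclusion_smooth (FCd Fl).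
have sC := inclusion_smooth (Cd Fl).
have sL := @Ld_smooth _ _ _ S.
have fC := is_form1_pullback1 cQ sC (is_form1_theta_plus sL).
have fF := is_form1_pullback1 cQ si (is_form1_theta_minus sL).
have fFC := is_form1_pullback1 (has_coordinates_rV _) sF fF.
have -> : xi = fun c w =>
    pullback1 (inclusion (Cd Fl)) (theta_plus (Ld S)) c w -
    pullback1 (@flow _ _ _ _ Fl)
      (pullback1 (inclusion (FCd Fl)) (theta_minus (Ld S))) c w.
  apply/functional_extensionality_dep => c; apply/funext => w.
  by rewrite xiE /pullback1 /theta_minus tangent_flow_shift.
split=> [|c u v]; first exact: is_form1B.
rewrite (ext_dB _ _ fC fFC) (ext_d_pullback1 cQ sC _ _ (is_form1_theta_plus sL)).
rewrite (ext_d_pullback1 (has_coordinates_rV _) sF _ _ fF).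
rewrite /pullback2 (ext_d_pullback1 cQ si _ _ (is_form1_theta_minus sL)).
rewrite /pullback2 /Omega ext_d_theta_minus//.
by rewrite addrA addNr add0r.
Qed.
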